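(* Let $\mathcal{H}$ be a real Hilbert space and let $T:\mathcal{H}\rightrightarrows\mathcal{H}$ be a maximally monotone operator such that $\operatorname{zer}T\neq\emptyset$. Let $x^0,x^1,x^2,y^0,y^1,v^1\in\mathcal{H}$, let $\alpha,\sigma\geq 0$ and $\underline{c}>0$ be real numbers, and let $(c_k)_{k\geq 1}$ and $(\alpha_k)_{k\geq 1}$ be real sequences such that $$c_k\geq\underline{c}>0\quad\text{and}\quad 0\leq\alpha_k\leq\alpha\qquad\forall k\geq 1,$$ $$\alpha(5+4\sigma^2)+\sigma^2<1.$$ Suppose that $(\alpha_k)_{k\geq 1}$ is nondecreasing and that either $\alpha_1=0$ or $x^1=x^0$. Let the sequences $(x^k)_{k\in\mathbb{N}}$, $(y^k)_{k\in\mathbb{N}}$, $(v^k)_{k\geq 1}$ in $\mathcal{H}$ and $(\varepsilon_k)_{k\geq 2}$ in $[0,+\infty)$ (with the given initial points) be generated by the following scheme, that is, suppose that for every $k\geq 2$: (a) $\varepsilon_k\geq 0$, $v^k\in T^{[\varepsilon_k]}(y^k)$ and $$2c_k\varepsilon_k+\|c_kv^k+y^k-x^k-\alpha_k(x^k-x^{k-1})\|^2+4\alpha_k\|c_{k-1}v^{k-1}+y^{k-1}-x^{k-1}-\alpha_{k-1}(x^{k-1}-x^{k-2})\|^2$$ $$\leq\sigma^2\|y^k-x^k\|^2+4\alpha_k\sigma^2\|y^{k-1}-x^{k-1}\|^2;$$ (b) $x^{k+1}=x^k+\alpha_k(x^k-x^{k-1})-c_kv^k$. Then the following statements are true: (i)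 $\sum_{k\in\mathbb{N}}\|x^{k+1}-x^k\|^2<+\infty$, $\sum_{k\in\mathbb{N}}\|x^k-y^k\|^2<+\infty$, $\sum_{k\geq 1}\|v^k\|^2<+\infty$ and $\sum_{k\geq 2}\varepsilon_k<+\infty$; (ii) $(x^k)_{k\in\mathbb{N}}$ converges weakly to an element of $\operatorname{zer}T$.
   Context: $\mathbb{N}=\{0,1,2,\dots\}$. $\mathcal{H}$ is a real Hilbert space with inner product $\langle\cdot,\cdot\rangle$ and associated norm $\|\cdot\|=\sqrt{\langle\cdot,\cdot\rangle}$. Superscripts on $x^k,y^k,v^k$ are sequence indices. For a set-valued operator $T:\mathcal{H}\rightrightarrows\mathcal{H}$, its graph is $\operatorname{Gr}T=\{(x,u)\in\mathcal{H}\times\mathcal{H}:u\in Tx\}$ and its set of zeros is $\operatorname{zer}T=\{x\in\mathcal{H}:0\in Tx\}$. $T$ is monotone if $\langle x-y,u-v\rangle\geq 0$ for all $(x,u),(y,v)\in\operatorname{Gr}T$; a monotone operator $T$ is maximally monotone if there is no proper monotone extension of the graph of $T$ in $\mathcal{H}\times\mathcal{H}$. For a monotone operator $T$ and $\varepsilon\geq 0$, the $\varepsilon$-enlargement $T^{[\varepsilon]}:\mathcal{H}\rightrightarrows\mathcal{H}$ of $T$ is defined by $$T^{[\varepsilon]}(x)=\{u\in\mathcal{H}:\langle x-y,u-v\rangle\geq-\varepsilon\ \ \forall (y,v)\in\operatorname{Gr}T\}.$$ *)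

(* Defs.v *)
From HB Require Import structures.
From mathcomp Require Import all_boot all_order all_algebra.
From mathcomp Require Import sesquilinear.
From mathcomp Require Import all_classical all_reals all_analysis.

Set Implicit Arguments.
Unset Strict Implicit.
Unset Printing Implicit Defensive.

Import Order.TTheory GRing.Theory Num.Theory.
Import numFieldNormedType.Exports.

Local Open Scope classical_set_scope.
Local Open Scope ring_scope.

(* A real Hilbert space is a complete normed module [H] together with a
   symmetric positive definite bilinear form [ip : {dot H for idfun}] that
   induces the norm of [H]. *)
Definition induces_norm (R : realType) (H : normedModType R)
    (ip : {dot H for idfun}) : Prop :=
  forall x : H, `|x| = Num.sqrt (ip x x).

Section Operators.
Context {R : realType} {H : normedModType R}.
Implicit Types (ip : {dot H for idfun}) (T S : H -> set H).

Definition graph_of T : set (H * H) := [set p | T p.1 p.2].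

Definition zer T : set H := [set x | T x 0].

Definition monotone_op ip T : Prop :=
  forall x u y v, graph_of T (x, u) -> graph_of T (y, v) ->
    0 <= ip (x - y) (u - v).

Definition maximally_monotone ip T : Prop :=
  monotone_op ip T /\
  forall S, monotone_op ip S -> graph_of T `<=` graph_of S ->
    graph_of S = graph_of T.

Definition enlargement ip T (eps : R) : H -> set H :=
  fun x => [set u | forall y v, graph_of T (y, v) ->
                      - eps <= ip (x - y) (u - v)].

Definition weakly_converges ip (x : nat -> H) (l : H) : Prop :=
  forall u : H, (fun k => ip (x k) u) @ \oo --> ip l u.

End Operators.

(* Main.v *)
Require Import Defs.
From HB Require Import structures.
From mathcomp Require Import all_boot all_order all_algebra.
From mathcomp Require Import sesquilinear.
From mathcomp Require Import all_classical all_reals all_analysis.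
From mathcomp Require Import ring lra.

Set Implicit Arguments.
Unset Strict Implicit.
Unset Printing Implicit Defensive.

Import Order.TTheory GRing.Theory Num.Theory.
Import numFieldNormedType.Exports.

Local Open Scope classical_set_scope.
Local Open Scope ring_scope.

(** The proof combines a Lyapunov function with the argument of Opial.

Fix a zero [z] of [T] and put [phi k = `|x k - z|^2], [gap k = `|x k - y k|^2].
For [k >= 3], expanding the new iterate ([inertial_step_identity]) and using
that [v k] lies in the [eps k]-enlargement of [T] at [y k] gives, once the
distance from [x k.-1] to [y k] is split through [x k] and [y k.-1] and the
error criterion is inserted,
  [phi k.+1 - phi k - alpha_ k * (phi k - phi k.-1)
     <= 4 * (1 + sigma^2) * alpha_ k * gap k.-1
        - (1 - sigma^2 - alpha_ k) * gap k]
([inertial_fejer]).  The error criterion carries the term [4 * alpha_ k] times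
the previous residual because the splitting produces exactly this
term.  Since [alpha_] is nondecreasing, the quantity
  [mu k = phi k - alpha_ k * phi k.-1
          + 4 * (1 + sigma^2) * alpha_ k * gap k.-1]
then decreases by at least
[(1 - sigma^2 - alpha * (5 + 4 * sigma^2)) * gap k].  It is bounded below,
because its monotonicity bounds [phi]; hence [gap] is summable
([lyapunov_series]).  Moreover [mu] converges, so does
[phi k - alpha_ k * phi k.-1], and as [alpha_] converges to a limit below [1],
[phi] itself converges ([lyapunov_cvg]).  The other series are
dominated, up to constants and from some index on, by [gap k + gap k.-1] and its
shift.

For the weak limit, the sequence is bounded, and a bounded sequence converges
weakly along every ultrafilter on the indices: the limits of the scalars
[ip (x k) u] form a bounded linear functional of [u], which is represented by a
vector ([riesz_representation], [weak_ultra_cvg]).  As [v], [eps] and [x - y]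
tend to [0], maximality of [T] puts each of these weak limits in [zer T]
([demiclosed]).  Convergence of [`|x k - z|] for every zero [z] forces all these
limits to coincide, and a sequence with the same limit along all ultrafilters
converges ([opial]). *)

(** * Series and convergence of sequences *)

Lemma sum_nat_shift (V : zmodType) (u : nat -> V) (N n : nat) :
  \sum_(N <= k < n + N) u k = series (fun n => u (n + N)%N) n.
Proof.
by rewrite /series /= -[X in \sum_(X <= _ < _) _]add0n big_addn addnK.
Qed.

Lemma is_cvg_series_shift (R : realType) (u : nat -> R) (N : nat) :
  cvgn (series (fun n => u (n + N)%N)) -> cvgn (series u).
Proof.
move=> /cvg_ex[l ul]; rewrite -(is_cvg_series_restrict N).
apply/cvg_ex; exists l; rewrite -(cvg_shiftn N).
apply: cvg_trans ul; apply: near_eq_cvg; near=> n.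
by rewrite /= sum_nat_shift.
Unshelve. all: by end_near. Qed.

Lemma is_cvg_series_pred (R : realType) (u : nat -> R) :
  cvgn (series u) -> cvgn (series (fun n => u n.-1)).
Proof.
move=> us; apply: (@is_cvg_series_shift _ _ 1%N).
by under eq_fun do rewrite addn1.
Qed.

Lemma is_cvg_series_dom (R : realType) (K : R) (u w : nat -> R) (N : nat) :
  (forall n, (N <= n)%N -> 0 <= u n <= K * w n) ->
  cvgn (series w) -> cvgn (series u).
Proof.
move=> uw ws; apply: (@is_cvg_series_shift _ _ N).
have uwN n : 0 <= u (n + N)%N <= K * w (n + N)%N by apply: uw; exact: leq_addl.
apply: (@series_le_cvg _ _ (fun n => K * w (n + N)%N)) => [n|n|n|].
- by case/andP: (uwN n).
- by case/andP: (uwN n); exact: le_trans.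
- by case/andP: (uwN n).
have -> : series (fun n => K * w (n + N)%N) =
    (fun n => K * series (fun n => w (n + N)%N) n).
  by apply/funext => n; rewrite /series /= mulr_sumr.
apply: is_cvgMl_tmp.
move: ws; rewrite -(is_cvg_series_restrict N) => /cvg_ex[l].
rewrite -(cvg_shiftn N) => wl; apply/cvg_ex; exists l.
apply: cvg_trans wl; apply: near_eq_cvg; near=> n.
by rewrite /= sum_nat_shift.
Unshelve. all: by end_near. Qed.

Lemma cvg_series_lt_pinfty (R : realType) (u : nat -> R) (m : nat) :
  cvgn (series u) -> (\sum_(m <= k <oo) (u k)%:E < +oo)%E.
Proof.
rewrite -(is_cvg_series_restrict m) => us.
rewrite (_ : (fun _ => _) = EFin \o (fun n => \sum_(m <= k < n) u k)).
  by rewrite EFin_lim // ltry.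
by apply/funext => n; rewrite /= sumEFin.
Qed.

(** The error [`|u n - l / (1 - r)|] contracts by the factor [r] up to a
perturbation that tends to [0]. *)
Lemma perturbed_contraction_cvg (R : realType) (r l : R) (u : nat -> R) :
  0 <= r -> r < 1 -> (fun n => u n.+1 - r * u n) @ \oo --> l ->
  u @ \oo --> l / (1 - r).
Proof.
move=> r0 r1 ul; set L := l / (1 - r).
have r1' : 0 < 1 - r by rewrite subr_gt0.
have lE : l = L - r * L by rewrite /L; field; rewrite gt_eqF.
apply/cvgrPdist_le => e e0.
have e2 : 0 < e / 2 by rewrite divr_gt0.
have [N _ uN] := (cvgrPdist_le _ _).1 ul _ (mulr_gt0 r1' e2).
have dist n : `|L - u (n + N)%N| <= e / 2 + r ^+ n * `|L - u N|.
  elim: n => [|n IH]; first by rewrite expr0 mul1r add0n lerDr ltW.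
  have := uN (n + N)%N (leq_addl _ _); rewrite /= -addSn => H.
  (* L is the fixed point of t |-> r * t + l. *)
  have -> : L - u (n.+1 + N)%N =
      (l - (u (n.+1 + N)%N - r * u (n + N)%N)) + r * (L - u (n + N)%N).
    by rewrite lE; ring.
  apply: le_trans (ler_normD _ _) _; rewrite normrM (ger0_norm r0) exprS.
  have := ler_wpM2l r0 IH; move: H; lra.
have rn0 : (fun n => r ^+ n * `|L - u N|) @ \oo --> 0.
  by rewrite -[0](mul0r `|L - u N|); apply: cvgMr_tmp; apply: cvg_expr;
    rewrite ger0_norm.
have [M _ rM] := (cvgrPdist_le _ _).1 rn0 _ e2.
exists (M + N)%N => // n /= MNn.
have Nn : (N <= n)%N by exact: leq_trans (leq_addl _ _) MNn.
have := dist (n - N)%N; rewrite subnK // => /le_trans; apply.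
have /rM /= : (M <= n - N)%N by rewrite leq_subRL // addnC.
rewrite sub0r normrN ger0_norm; first by lra.
by rewrite mulr_ge0 ?exprn_ge0.
Qed.

Lemma sqr_norm_cvg0 {R : realType} {V : normedModType R}
    {I : Type} {F : set_system I} {FF : Filter F} (f : I -> V) :
  (fun n => `|f n| ^+ 2) @ F --> 0 -> f @ F --> 0.
Proof.
move=> f0; apply/cvgr0Pnorm_lt => e e0.
have e2 : 0 < e ^+ 2 by rewrite exprn_gt0.
near=> n; rewrite -ltr_sqr ?nnegrE ?(ltW e0) //.
rewrite -[X in X < _]ger0_norm ?sqr_ge0 //; near: n.
exact: cvgr0_norm_lt f0 _ e2.
Unshelve. all: by end_near. Qed.

Lemma bounded_sqr_dist {R : realType} {V : normedModType R}
    (x : nat -> V) (z : V) :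
  cvgn (fun n => `|x n - z| ^+ 2) -> exists B, forall n, `|x n| <= B.
Proof.
move=> /cvg_seq_bounded/bounded_fun_has_ubound[M xM].
exists (`|z| + (M + 1)) => n; rewrite -[x n](subrK z) addrC.
apply: le_trans (ler_normD _ _) _; rewrite lerD2l.
have {xM} : `|x n - z| ^+ 2 <= M by apply: xM; exists n.
(* t ^ 2 <= M gives t <= M + 1, because t <= t ^ 2 + 1/4. *)
have := sqr_ge0 (`|x n - z| - 2^-1); lra.
Qed.

(** * A Lyapunov function for inertial recursions *)

Section Lyapunov.
Context {R : realType}.
Variables (phi a al : nat -> R) (q s b : R).
Hypotheses (phi_ge0 : forall n, 0 <= phi n) (a_ge0 : forall n, 0 <= a n).
Hypotheses (al_bnd : forall n, 0 <= al n <= q).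
Hypothesis al_ndecr : forall n, al n <= al n.+1.
Hypotheses (b_ge0 : 0 <= b) (s_ge0 : 0 <= s) (qbs : q * (1 + b) + s < 1).
Hypothesis step : forall n,
  phi n.+2 - phi n.+1 - al n * (phi n.+1 - phi n)
    <= b * al n * a n - (1 - s - al n) * a n.+1.

(** The last term absorbs the positive contribution of [a n] to the recursion;
the term that it adds at the next index is paid for by the negative coefficient
of [a n.+1]. *)
Let mu n := phi n.+1 - al n * phi n + b * al n * a n.
Let delta := 1 - s - q * (1 + b).

Let q_ge0 : 0 <= q.
Proof. by case/andP: (al_bnd 0); exact: le_trans. Qed.

Let q_lt1 : q < 1.
Proof. have := mulr_ge0 q_ge0 b_ge0; move: s_ge0 qbs; lra. Qed.

Let mu_decr n : mu n.+1 <= mu n - delta * a n.+1.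
Proof.
rewrite /mu /delta; have := step n.
have /andP[_ aq] := al_bnd n; have /andP[_ aq'] := al_bnd n.+1.
have h1 : 0 <= (al n.+1 - al n) * phi n.+1.
  by rewrite mulr_ge0 // subr_ge0.
have h2 : 0 <= (q - al n) * a n.+1 by rewrite mulr_ge0 // subr_ge0.
have h3 : 0 <= b * ((q - al n.+1) * a n.+1).
  by rewrite mulr_ge0 // mulr_ge0 // subr_ge0.
move: h1 h2 h3; lra.
Qed.

Let delta_gt0 : 0 < delta. Proof. by move: qbs; rewrite /delta; lra. Qed.

Let mu_nincr : nonincreasing_seq mu.
Proof.
apply/nonincreasing_seqP => n; apply: le_trans (mu_decr n) _.
by rewrite gerBl mulr_ge0 // ltW.
Qed.

Let B := Num.max (phi 0) (`|mu 0| / (1 - q)).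

(** As [mu n <= mu 0], the recursion [phi n.+1 <= q * phi n + `|mu 0|] keeps
[phi] below the larger of its first value and the fixed point. *)
Let phi_bnd n : phi n <= B.
Proof.
elim: n => [|n IH]; first by rewrite le_max lexx.
have m0 : mu n <= `|mu 0|.
  by apply: le_trans (ler_norm _); exact: mu_nincr.
have hB : `|mu 0| <= (1 - q) * B.
  by rewrite mulrC -ler_pdivrMr ?subr_gt0 // le_max lexx orbT.
have /andP[an0 anq] := al_bnd n.
have h1 : 0 <= b * al n * a n by rewrite !mulr_ge0.
have h2 : 0 <= (q - al n) * phi n by rewrite mulr_ge0 // subr_ge0.
have h3 : q * phi n <= q * B by rewrite ler_wpM2l.
move: m0; rewrite {1}/mu; lra.
Qed.

Let mu_lb n : - (q * B) <= mu n.
Proof.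
have /andP[an0 anq] := al_bnd n.
have h1 : 0 <= b * al n * a n by rewrite !mulr_ge0.
have h2 : 0 <= (q - al n) * phi n by rewrite mulr_ge0 // subr_ge0.
have h3 : q * phi n <= q * B by rewrite ler_wpM2l.
have := phi_ge0 n.+1; rewrite /mu; lra.
Qed.

(** Telescoping the decrease of [mu], which is bounded below. *)
Lemma lyapunov_series : cvgn (series a).
Proof.
apply: (@is_cvg_series_shift _ _ 1%N).
apply: nondecreasing_is_cvgn; first exact: nondecreasing_series.
have sumE n : delta * series (fun n => a (n + 1)%N) n <= mu 0 - mu n.
  elim: n => [|n IH]; first by rewrite /series /= big_nil mulr0 subrr.
  rewrite seriesSr mulrDr addn1; have := mu_decr n; lra.
exists ((mu 0 + q * B) / delta) => _ [n _ <-].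
rewrite ler_pdivlMr // mulrC; apply: le_trans (sumE n) _.
by rewrite lerD2l lerNl; exact: mu_lb.
Qed.

(** [mu] converges by monotonicity, [al] as well, and [a] tends to [0]; so
[phi n.+1 - r * phi n] converges, where [r < 1] is the limit of [al], and
[phi] converges with it. *)
Lemma lyapunov_cvg : cvgn phi.
Proof.
have mu_cvg : cvgn mu.
  apply: nonincreasing_is_cvgn => //; exists (- (q * B)) => _ [n _ <-] //.
have al_cvg : cvgn al.
  apply: nondecreasing_is_cvgn; first exact/nondecreasing_seqP.
  by exists q => _ [n _ <-]; case/andP: (al_bnd n).
have a0 : a @ \oo --> 0 by apply: cvg_series_cvg_0; exact: lyapunov_series.
set l := limn mu; set r := limn al.
have r_ge0 : 0 <= r.
  by apply: limr_ge => //; apply: nearW => n; case/andP: (al_bnd n).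
have r_lt1 : r < 1.
  apply: le_lt_trans q_lt1.
  by apply: limr_le => //; apply: nearW => n; case/andP: (al_bnd n).
have corr0 : (fun n => b * al n * a n) @ \oo --> 0.
  by rewrite -[0](mulr0 (b * r)); apply: cvgM => //; apply: cvgMl_tmp.
have drift0 : (fun n => (al n - r) * phi n) @ \oo --> 0.
  have env0 : (fun n => `|al n - r| * B) @ \oo --> 0.
    rewrite -[0](mul0r B); apply: cvgMr_tmp.
    have /cvg_norm : (fun n => al n - r) @ \oo --> 0 by apply/subr_cvg0.
    by rewrite normr0.
  have envN0 : (fun n => - (`|al n - r| * B)) @ \oo --> 0.
    by rewrite -oppr0; exact: cvgN.
  apply: (squeeze_cvgr _ envN0 env0); apply: nearW => n /=.
  by rewrite -ler_norml normrM (ger0_norm (phi_ge0 n)) ler_wpM2l.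
apply/cvg_ex; exists (l / (1 - r)); apply: perturbed_contraction_cvg => //.
have -> : (fun n => phi n.+1 - r * phi n) =
    (fun n => mu n - b * al n * a n + (al n - r) * phi n).
  by apply/funext => n; rewrite /mu; ring.
rewrite -[l]addr0 -[l]subr0; apply: cvgD => //; apply: cvgB => //.
Qed.

End Lyapunov.

(** * The inner product *)

Section InnerProduct.
Context {R : realType} {H : normedModType R} (ip : {dot H for idfun}).

Lemma ipC u w : ip u w = ip w u.
Proof. by rewrite hermC expr0 mul1r. Qed.

Lemma ipZl a u w : ip (a *: u) w = a * ip u w.
Proof. by rewrite linearZl_LR. Qed.

Lemma ipZr a u w : ip u (a *: w) = a * ip u w.
Proof. by rewrite ipC ipZl ipC. Qed.

Lemma ipDl u u' w : ip (u + u') w = ip u w + ip u' w.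
Proof. exact: linearDl. Qed.

Lemma ipDr u w w' : ip u (w + w') = ip u w + ip u w'.
Proof. exact: linearDr. Qed.

Lemma ipBl u u' w : ip (u - u') w = ip u w - ip u' w.
Proof. exact: linearBl. Qed.

Lemma ipBr u w w' : ip u (w - w') = ip u w - ip u w'.
Proof. exact: linearBr. Qed.

Definition ipE := (ipBl, ipBr, ipDl, ipDr, ipZl, ipZr).

End InnerProduct.

Section InducedNorm.
Context {R : realType} {H : normedModType R} {ip : {dot H for idfun}}.
Hypothesis ip_norm : induces_norm ip.

Lemma normE (u : H) : `|u| ^+ 2 = ip u u.
Proof.
rewrite ip_norm sqr_sqrtr //; have [->|u0] := eqVneq u 0.
  by rewrite linear0l.
exact/ltW/neq0_dnorm_gt0.
Qed.

Lemma sqr_normD (u w : H) : `|u + w| ^+ 2 = `|u| ^+ 2 + 2 * ip u w + `|w| ^+ 2.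
Proof. rewrite !normE linearDl !linearDr /= (ipC _ w u); ring. Qed.

Lemma sqr_normB (u w : H) : `|u - w| ^+ 2 = `|u| ^+ 2 - 2 * ip u w + `|w| ^+ 2.
Proof. rewrite !normE linearBl !linearBr /= (ipC _ w u); ring. Qed.

Lemma sqr_normB_le2 (u w : H) : `|u - w| ^+ 2 <= 2 * `|u| ^+ 2 + 2 * `|w| ^+ 2.
Proof.
have := sqr_ge0 `|u + w|; rewrite sqr_normB sqr_normD; lra.
Qed.

Lemma ip_norm_le (u w : H) : `|ip u w| <= `|u| * `|w|.
Proof.
have [->|u0] := eqVneq u 0; first by rewrite linear0l normr0 mulr_ge0.
have nu : 0 < `|u| by rewrite normr_gt0.
rewrite -ler_sqr ?nnegrE ?mulr_ge0 // exprMn real_normK ?num_real //.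
(* The component of w orthogonal to u has nonnegative square norm. *)
have := sqr_ge0 `|w - (ip u w / `|u| ^+ 2) *: u|.
rewrite sqr_normB ipZr (ipC _ w u) normrZ exprMn real_normK ?num_real //.
have -> : `|w| ^+ 2 - 2 * (ip u w / `|u| ^+ 2 * ip u w) +
    (ip u w / `|u| ^+ 2) ^+ 2 * `|u| ^+ 2 = `|w| ^+ 2 - ip u w ^+ 2 / `|u| ^+ 2.
  by field; rewrite gt_eqF.
by rewrite subr_ge0 ler_pdivrMr ?exprn_gt0 // mulrC.
Qed.

(** With [p] and [q] the current and previous iterates and [al] the inertial
coefficient, the next iterate is [p + al *: (p - q) - u], where [u] is the step
length times the selected element [v].  Besides the residual, only differences
of the form [`|_ - z|^2 - `|_ - y|^2] occur on the right: the extrapolation adds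
the same multiple of [`|p - q|^2] to the squared distances to [z] and to [y], so
these terms cancel. *)
Lemma inertial_step_identity (al : R) (p q y z u : H) :
  `|p + al *: (p - q) - u - z| ^+ 2 + 2 * ip (y - z) u
  = `|u + y - p - al *: (p - q)| ^+ 2
    + (1 + al) * (`|p - z| ^+ 2 - `|p - y| ^+ 2)
    - al * (`|q - z| ^+ 2 - `|q - y| ^+ 2).
Proof.
rewrite !normE !ipE /=.
rewrite (ipC _ q p) (ipC _ y p) (ipC _ z p) (ipC _ u p) (ipC _ y q) (ipC _ z q).
rewrite (ipC _ u q) (ipC _ u y) (ipC _ u z).
ring.
Qed.

End InducedNorm.

(** * Weak limits of bounded families *)

Section WeakCompactness.
Context {R : realType} {H : completeNormedModType R} {ip : {dot H for idfun}}.
Hypothesis ip_norm : induces_norm ip.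

Lemma ip_cvg0 {I : Type} {F : set_system I} {FF : Filter F} (f g : I -> H)
    (B : R) :
  f @ F --> 0 -> (\forall k \near F, `|g k| <= B) ->
  (fun k => ip (f k) (g k)) @ F --> 0.
Proof.
move=> f0 gB.
have env0 : (fun k => `|f k| * B) @ F --> 0.
  rewrite -[0](mul0r B); apply: cvgMr_tmp.
  by have /cvg_norm := f0; rewrite normr0.
have envN0 : (fun k => - (`|f k| * B)) @ F --> 0.
  by rewrite -oppr0; exact: cvgN.
apply: (squeeze_cvgr _ envN0 env0); near=> k.
rewrite -ler_norml; apply: le_trans (ip_norm_le ip_norm _ _) _.
by rewrite ler_wpM2l //; near: k.
Unshelve. all: by end_near. Qed.

Lemma ip_cvgl {I : Type} {F : set_system I} {FF : Filter F} (f : I -> H)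
    (p u : H) :
  f @ F --> p -> (fun k => ip (f k) u) @ F --> ip p u.
Proof.
move=> fp; apply/subr_cvg0; under eq_cvg do rewrite -linearBl.
by apply: (@ip_cvg0 _ _ _ _ _ `|u|); [apply/subr_cvg0|exact: nearW].
Qed.

(** The representing vector minimizes [J u = `|u|^2 - 2 * l u].  By the
parallelogram law two near-minimizers are close to each other, so the sublevel
sets of [J] above its infimum [m] generate a Cauchy filter; its limit [p] is the
minimizer, and the first variation of [J] at [p] vanishes. *)
Theorem riesz_representation (l : H -> R) (M : R) :
  scalar l -> (forall u, `|l u| <= M * `|u|) ->
  exists p, forall u, l u = ip p u.
Proof.
move=> l_lin l_bnd.
pose J u := `|u| ^+ 2 - 2 * l u.
have lD u w : l (u + w) = l u + l w by rewrite -[u]scale1r l_lin !mul1r scale1r.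
have l0 : l 0 = 0 by have := lD 0 0; rewrite addr0; lra.
have lZ a u : l (a *: u) = a * l u by rewrite -[a *: u]addr0 l_lin l0 addr0.
have J_has_lb : has_lbound (range J).
  exists (- M ^+ 2) => _ [u _ <-]; rewrite /J.
  have := sqr_ge0 (`|u| - M); have := l_bnd u.
  have := ler_norm (l u); lra.
pose m := inf (range J).
have m_le u : m <= J u by apply: ge_inf => //; exists u.
have J_near e : 0 < e -> exists u, J u < m + e.
  move=> e0; have [] := @inf_adherent _ (range J) e e0.
    by split=> //; exists (J 0); exists 0.
  by move=> _ [u _ <-] Ju; exists u.
pose F := filter_from [set e : R | 0 < e] (fun e => [set u | J u < m + e]).
have FF : ProperFilter F.
  apply: filter_from_proper => [|e e0]; last exact: J_near.
  apply: filter_from_filter => [|e d e0 d0]; first by exists 1; exact: ltr01.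
  exists (Num.min e d) => [|u /= Ju]; first by rewrite /= lt_min e0.
  by split; apply: (lt_le_trans Ju); rewrite lerD2l ge_min lexx ?orbT.
(* The parallelogram law applied at the midpoint of u and w. *)
have dist u w : `|u - w| ^+ 2 <= 2 * (J u - m) + 2 * (J w - m).
  have := m_le (2^-1 *: (u + w)).
  rewrite /J lZ lD normrZ exprMn (sqr_normD ip_norm) (sqr_normB ip_norm).
  rewrite ger0_norm ?invr_ge0 //; lra.
have cauchyF : cauchy F.
  apply: cauchy_exP => e e0; have d0 : 0 < e ^+ 2 / 4.
    by rewrite divr_gt0 ?exprn_gt0.
  have [u Ju] := J_near _ d0; exists u; exists (e ^+ 2 / 4) => // w /= Jw.
  rewrite -ball_normE /= -ltr_sqr ?nnegrE ?(ltW e0) //.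
  have := dist u w; lra.
have [p Fp] : exists p : H, F --> p.
  by move/cauchy_cvgP : cauchyF => Fc; exists (lim F).
exists p => w; apply/eqP; rewrite eq_sym -subr_eq0; apply/eqP.
(* The right-hand side is the limit of J (u + t *: w) - J u along F, and
   J (u + t *: w) >= m > J u - e for the u of a member of F. *)
have var t : 0 <= 2 * t * (ip p w - l w) + t ^+ 2 * `|w| ^+ 2.
  apply/ler_addgt0Pl => e e0; rewrite addrC -lerBlDr sub0r.
  have cv : (fun u => 2 * t * (ip u w - l w) + t ^+ 2 * `|w| ^+ 2) @ F -->
      2 * t * (ip p w - l w) + t ^+ 2 * `|w| ^+ 2.
    apply: cvgD; last exact: cvg_cst.
    apply: cvgMl_tmp; apply: cvgB; last exact: cvg_cst.
    exact: (@ip_cvgl _ F _ id).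
  apply: (cvgr_to_ge cv); exists e => // u /= Ju.
  have := m_le (u + t *: w); rewrite /J lD lZ (sqr_normD ip_norm) ipZr.
  rewrite normrZ exprMn real_normK ?num_real //; move: Ju; rewrite /J; lra.
set g := ip p w - l w in var *; set n := `|w| ^+ 2 in var.
have n0 : 0 <= n by exact: sqr_ge0.
have n1 : 0 < n + 1 by lra.
(* The minimizer of the quadratic is - g / n; the denominator n + 1 covers
   w = 0 as well. *)
have := var (- g / (n + 1)).
have -> : 2 * (- g / (n + 1)) * g + (- g / (n + 1)) ^+ 2 * n =
    - (g ^+ 2 * (n + 2) / (n + 1) ^+ 2) by field; rewrite gt_eqF.
rewrite oppr_ge0 pmulr_lle0 ?invr_gt0 ?exprn_gt0 // pmulr_lle0; last by lra.
move=> g2; apply/eqP; rewrite -sqrf_eq0; apply/eqP/le_anti.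
by rewrite g2 sqr_ge0.
Qed.

(** Compactness of the interval gives a cluster point, and along an ultrafilter
a cluster point is a limit. *)
Lemma bounded_ultra_cvg {I : Type} (U : set_system I) (f : I -> R) (B : R) :
  UltraFilter U -> (forall k, `|f k| <= B) -> exists t : R, f @ U --> t.
Proof.
move=> UU fB.
have UP : ProperFilter (f @ U)
  by apply: fmap_proper_filter; exact: ultra_proper.
have UB : (f @ U) `[- B, B]%classic.
  by apply: (@filterE _ U) => k /=; rewrite in_itv /= -ler_norml.
have [t [_ tcl]] := @segment_compact R (- B) B _ UP UB.
exists t => A tA; have [//|UnA] := in_ultra_setVsetC (f @^-1` A) UU.
by have [s [nAs As]] := tcl (~` A) A UnA tA.
Qed.

(** Along an ultrafilter the scalar products with all vectors [u] converge at
once, and their limits depend linearly and boundedly on [u]. *)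
Lemma weak_ultra_cvg {I : Type} (U : set_system I) (x : I -> H) (B : R) :
  UltraFilter U -> (forall k, `|x k| <= B) ->
  exists p, forall u, (fun k => ip (x k) u) @ U --> ip p u.
Proof.
move=> UU xB.
have ipB u k : `|ip (x k) u| <= B * `|u|.
  by apply: le_trans (ip_norm_le ip_norm _ _) _; rewrite ler_wpM2r.
pose l u := lim ((fun k => ip (x k) u) @ U).
have lP u : (fun k => ip (x k) u) @ U --> l u.
  by have [t ut] := bounded_ultra_cvg UU (ipB u); apply/cvg_ex; exists t.
have [|u|p lp] := @riesz_representation l B.
- move=> a u w; apply/cvg_lim => //.
  under eq_cvg do rewrite linearDr /= ipZr.
  by apply: cvgD => //; apply: cvgMl_tmp.
- have /cvg_norm lPn := lP u.
  by apply: (cvgr_to_le lPn); apply: nearW => k; exact: ipB.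
by exists p => u; rewrite -lp.
Qed.

End WeakCompactness.

(** * Zeros of maximally monotone operators and the lemma of Opial *)

Section Opial.
Context {R : realType} {H : completeNormedModType R} {ip : {dot H for idfun}}.
Hypothesis ip_norm : induces_norm ip.

(** The products [ip (y k - q) (v k - b)] pass to the limit since one factor
converges strongly and the other weakly and boundedly.  So [(p, 0)] is
monotonically related to the graph of [T], and adding it to the graph yields a
monotone extension, which maximality identifies with [T]. *)
Lemma demiclosed {T : H -> set H} {I : Type} {F : set_system I}
    {FF : ProperFilter F} (y v : I -> H) (e : I -> R) (p : H) (B : R) :
  maximally_monotone ip T ->
  (\forall k \near F, enlargement ip T (e k) (y k) (v k)) ->
  (\forall k \near F, `|y k| <= B) -> e @ F --> 0 -> v @ F --> 0 ->
  (forall u, (fun k => ip (y k) u) @ F --> ip p u) ->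
  zer T p.
Proof.
move=> [Tmon Tmax] yv yB e0 v0 yp.
have key q b : T q b -> 0 <= ip (p - q) (0 - b).
  move=> Tqb.
  have lim1 : (fun k => ip (y k - q) (v k - b) + e k) @ F -->
      ip (p - q) (0 - b).
    have -> : ip (p - q) (0 - b) = 0 - ip p b - (0 - ip q b) + 0.
      by rewrite !ipE linear0r /=; ring.
    have -> : (fun k => ip (y k - q) (v k - b) + e k) =
      (fun k => ip (v k) (y k) - ip (y k) b - (ip (v k) q - ip q b) + e k).
      apply/funext => k; rewrite !ipE /= (ipC _ (v k) (y k)) (ipC _ (v k) q).
      ring.
    apply: cvgD => //; apply: cvgB; apply: cvgB.
    - exact: (ip_cvg0 ip_norm v0 yB).
    - exact: yp.
    - by rewrite -[0](linear0l ip q); exact: (ip_cvgl ip_norm).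
    - exact: cvg_cst.
  apply: (cvgr_to_ge lim1); near=> k.
  rewrite -lerBlDr sub0r.
  suff /(_ q b Tqb) : enlargement ip T (e k) (y k) (v k) by [].
  by near: k.
pose S a := T a `|` [set b | a = p /\ b = 0].
have Smon : monotone_op ip S.
  move=> a b a' b'; rewrite /graph_of /=.
  move=> [Tab|[-> ->]] [Tab'|[-> ->]].
  - exact: Tmon Tab Tab'.
  - by rewrite -(opprB p a) -(opprB 0 b) linearNl linearNr /= opprK; exact: key.
  - exact: key.
  - by rewrite subrr linear0l.
have TS : graph_of T `<=` graph_of S by move=> [a b] Tab; left.
have := Tmax _ Smon TS; rewrite predeqE => /(_ (p, 0)) [+ _]; apply.
by right.
Unshelve. all: by end_near. Qed.

(** [`|x n - p|^2 - `|x n - p'|^2] is affine in [ip (x n) (p - p')], so for [p]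
and [p'] in [Z] this scalar product converges; if both are weak limits along
ultrafilters, [ip p (p - p') = ip p' (p - p')], that is [p = p'].  If [x] did
not converge weakly to [p], an ultrafilter that avoids a neighbourhood of the
limit would provide a second weak limit. *)
Lemma opial (Z : set H) (x : nat -> H) :
  Z !=set0 -> (forall z, Z z -> cvgn (fun n => `|x n - z| ^+ 2)) ->
  (forall U p, UltraFilter U -> \oo `<=` U ->
    (forall u, (fun k => ip (x k) u) @ U --> ip p u) -> Z p) ->
  exists2 z, Z z & weakly_converges ip x z.
Proof.
move=> [z0 Zz0] xz Zcl.
have [B xB] := bounded_sqr_dist (xz _ Zz0).
have xU U : UltraFilter U -> \oo `<=` U ->
    exists2 p, Z p & forall u, (fun k => ip (x k) u) @ U --> ip p u.
  move=> UU oU; have [p xp] := weak_ultra_cvg ip_norm UU xB.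
  by exists p => //; exact: Zcl UU oU xp.
have uniq p p' U U' : Z p -> Z p' -> UltraFilter U -> UltraFilter U' ->
    \oo `<=` U -> \oo `<=` U' ->
    (forall u, (fun k => ip (x k) u) @ U --> ip p u) ->
    (forall u, (fun k => ip (x k) u) @ U' --> ip p' u) -> p = p'.
  move=> Zp Zp' UU UU' oU oU' xp xp'.
  have [t xt] : exists t : R, (fun k => ip (x k) (p - p')) @ \oo --> t.
    have /cvg_ex[a xa] := xz _ Zp; have /cvg_ex[a' xa'] := xz _ Zp'.
    exists (2^-1 * (`|p| ^+ 2 - `|p'| ^+ 2 - (a - a'))).
    have -> : (fun k => ip (x k) (p - p')) = (fun k => 2^-1 *
        (`|p| ^+ 2 - `|p'| ^+ 2 - (`|x k - p| ^+ 2 - `|x k - p'| ^+ 2))).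
      by apply/funext => k; rewrite !(sqr_normB ip_norm) linearBr /=; field.
    by apply: cvgMl_tmp; apply: cvgB; [exact: cvg_cst|exact: cvgB].
  have tU V (VV : UltraFilter V) : \oo `<=` V ->
      (fun k => ip (x k) (p - p')) @ V --> t.
    move=> oV A tA; exact: oV (xt _ tA).
  have pt : ip p (p - p') = t.
    rewrite -(cvg_lim (@Rhausdorff R) (xp _)).
    by apply: (cvg_lim (@Rhausdorff R)); exact: tU.
  have pt' : ip p' (p - p') = t.
    rewrite -(cvg_lim (@Rhausdorff R) (xp' _)).
    by apply: (cvg_lim (@Rhausdorff R)); exact: tU.
  apply/eqP; rewrite -subr_eq0 -normr_eq0 -sqrf_eq0 (normE ip_norm).
  by rewrite linearBl /= pt pt' subrr.
have [U [UU oU]] := ultraFilterLemma (_ : ProperFilter \oo).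
have [p Zp xp] := xU _ UU oU.
exists p => // u A pA.
have [//|nA] := pselect (((fun k => ip (x k) u) @ \oo) A).
(* Indices outside the neighbourhood are frequent, so the eventual filter
   restricted to them is proper. *)
pose D := ~` ((fun k => ip (x k) u) @^-1` A).
have PD : ProperFilter (within D \oo).
  split; last exact: within_filter.
  move=> D0; apply: nA.
  apply: (@filterS _ \oo _ (fun k => D k -> set0 k)) D0 => k Dk.
  by have [//|nAk] := pselect (A (ip (x k) u)); have := Dk nAk.
have [U' [UU' DU']] := ultraFilterLemma PD.
have oU' : \oo `<=` U' by move=> E oE; apply: DU'; exact: cvg_within oE.
have [p' Zp' xp'] := xU _ UU' oU'.
have pp' := uniq _ _ _ _ Zp Zp' UU UU' oU oU' xp xp'.
have U'A : U' ((fun k => ip (x k) u) @^-1` A) by apply: xp'; rewrite -pp'.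
have U'D : U' D by apply: DU'; exact: withinT.
by have [k [Ak nAk]] := filter_ex (filterI U'A U'D).
Qed.

End Opial.

(** * The inertial iteration *)

Section Iteration.
Context {R : realType} {H : completeNormedModType R} {ip : {dot H for idfun}}.
Hypothesis ip_norm : induces_norm ip.

Variables (T : H -> set H) (x y v : nat -> H) (eps c alpha_ : nat -> R).
Variables (alpha sigma c_low : R).
Hypotheses (alpha_ge0 : 0 <= alpha) (c_low_gt0 : 0 < c_low).
Hypothesis c_ge : forall k : nat, (1 <= k)%N -> c_low <= c k.
Hypothesis alpha_bnd : forall k : nat, (1 <= k)%N -> 0 <= alpha_ k <= alpha.
Hypothesis param_lt1 : alpha * (5 + 4 * sigma ^+ 2) + sigma ^+ 2 < 1.
Hypothesis alpha_ndecr : forall k : nat, (1 <= k)%N -> alpha_ k <= alpha_ k.+1.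
Hypothesis eps_ge0 : forall k : nat, (2 <= k)%N -> 0 <= eps k.
Hypothesis v_enl :
  forall k : nat, (2 <= k)%N -> enlargement ip T (eps k) (y k) (v k).
Hypothesis error_bnd : forall k : nat, (2 <= k)%N ->
  2 * c k * eps k
  + `|c k *: v k + y k - x k - alpha_ k *: (x k - x k.-1)| ^+ 2
  + 4 * alpha_ k *
    `|c k.-1 *: v k.-1 + y k.-1 - x k.-1
      - alpha_ k.-1 *: (x k.-1 - x k.-2)| ^+ 2
  <= sigma ^+ 2 * `|y k - x k| ^+ 2
     + 4 * alpha_ k * sigma ^+ 2 * `|y k.-1 - x k.-1| ^+ 2.
Hypothesis x_step : forall k : nat, (2 <= k)%N ->
  x k.+1 = x k + alpha_ k *: (x k - x k.-1) - c k *: v k.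

Let gap k : R := `|x k - y k| ^+ 2.
Let res k : R := `|c k *: v k + y k - x k - alpha_ k *: (x k - x k.-1)| ^+ 2.
Let incr k : R := `|x k.+1 - x k| ^+ 2.

Let gap_ge0 k : 0 <= gap k. Proof. exact: sqr_ge0. Qed.
Let res_ge0 k : 0 <= res k. Proof. exact: sqr_ge0. Qed.

Let c_gt0 k : (1 <= k)%N -> 0 < c k.
Proof. by move=> k1; exact: lt_le_trans (c_ge k1). Qed.

Let error_gap k : (2 <= k)%N ->
  2 * c k * eps k + res k + 4 * alpha_ k * res k.-1
    <= sigma ^+ 2 * gap k + 4 * alpha_ k * sigma ^+ 2 * gap k.-1.
Proof.
by move=> k2; rewrite /gap (distrC (x k)) (distrC (x k.-1)); exact: error_bnd.
Qed.

(** The residual in the error criterion compares [y k] with the next iterate;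
this links it to the displacement [x k.+1 - x k]. *)
Let res_next k : (2 <= k)%N -> res k = `|y k - x k.+1| ^+ 2.
Proof.
move=> k2; rewrite /res x_step //; congr (`|_| ^+ 2).
by rewrite opprB !opprD !addrA (addrC (y k)).
Qed.

Let incr_le k : (2 <= k)%N -> incr k <= 2 * gap k + 2 * res k.
Proof.
move=> k2; rewrite res_next // /gap (distrC (x k)) /incr.
have -> : x k.+1 - x k = (y k - x k) - (y k - x k.+1).
  by rewrite opprB [RHS]addrC addrA subrK.
exact: (sqr_normB_le2 ip_norm).
Qed.

(** The index starts at [3] because the bound on the distance from [x k.-1] to
[y k] uses that [x k] was produced by the scheme from [x k.-1]. *)
Lemma inertial_fejer z k : T z 0 -> (3 <= k)%N ->
  `|x k.+1 - z| ^+ 2 - `|x k - z| ^+ 2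
    - alpha_ k * (`|x k - z| ^+ 2 - `|x k.-1 - z| ^+ 2)
  <= 4 * (1 + sigma ^+ 2) * alpha_ k * gap k.-1
     - (1 - sigma ^+ 2 - alpha_ k) * gap k.
Proof.
case: k => [//|[//|[//|k]]] Tz0 _.
have /andP[al0 _] := @alpha_bnd k.+3 isT.
have := inertial_step_identity ip_norm (alpha_ k.+3) (x k.+3) (x k.+2)
  (y k.+3) z (c k.+3 *: v k.+3).
rewrite -(@x_step k.+3) // -/(res k.+3) -/(gap k.+3) ipZr.
have enl : 0 <= 2 * (c k.+3 * (ip (y k.+3 - z) (v k.+3) + eps k.+3)).
  have := @v_enl k.+3 isT z 0 Tz0; rewrite subr0 => h.
  by rewrite !mulr_ge0 ?(ltW (c_gt0 _)) // -lerBlDr sub0r.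
(* From x k.-1 to x k the path passes through y k.-1, which costs a gap and a
   residual. *)
have back : `|x k.+2 - y k.+3| ^+ 2
    <= 2 * gap k.+3 + 2 * (2 * gap k.+2 + 2 * res k.+2).
  have -> : x k.+2 - y k.+3 = (x k.+3 - y k.+3) - (x k.+3 - x k.+2).
    by rewrite opprB [RHS]addrC addrA subrK.
  apply: le_trans (sqr_normB_le2 ip_norm _ _) _; rewrite lerD2l.
  by rewrite ler_wpM2l //; exact: (@incr_le k.+2).
have := ler_wpM2l al0 back.
have := @error_gap k.+3 isT; move: enl; rewrite /=.
lra.
Qed.

Let sigma2_ge0 : 0 <= sigma ^+ 2. Proof. exact: sqr_ge0. Qed.

(** The recursion holds from [k = 3] on, so the Lyapunov argument runs on the
sequences that start at [x 2] and [y 2]. *)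
Let inertial_lyapunov z : T z 0 ->
  cvgn (series gap) /\ cvgn (fun n => `|x n - z| ^+ 2).
Proof.
move=> Tz0.
have step n := @inertial_fejer z n.+3 Tz0 isT.
have al_bnd n : 0 <= alpha_ n.+3 <= alpha by exact: alpha_bnd.
have al_ndecr n : alpha_ n.+3 <= alpha_ n.+4 by exact: alpha_ndecr.
have b0 : 0 <= 4 * (1 + sigma ^+ 2) by rewrite mulr_ge0 // addr_ge0.
have qbs : alpha * (1 + 4 * (1 + sigma ^+ 2)) + sigma ^+ 2 < 1.
  by move: param_lt1; lra.
have phi0 n : 0 <= `|x n.+2 - z| ^+ 2 by exact: sqr_ge0.
have gap0 n : 0 <= gap n.+2 by [].
split.
  apply: (@is_cvg_series_shift _ _ 2%N); under eq_fun do rewrite addn2.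
  exact: (lyapunov_series phi0 gap0 al_bnd al_ndecr b0 sigma2_ge0 qbs step).
have /cvg_ex[l xl] :=
  lyapunov_cvg phi0 gap0 al_bnd al_ndecr b0 sigma2_ge0 qbs step.
apply/cvg_ex; exists l; rewrite -(cvg_shiftn 2) /=.
by under eq_cvg do rewrite addn2.
Qed.

(** The hypothesis on the parameters makes both coefficients [sigma^2] and
[4 * alpha_ k * sigma^2] at most [1]. *)
Let error_le k : (2 <= k)%N -> 2 * c k * eps k + res k <= gap k + gap k.-1.
Proof.
move=> k2; have := error_gap k2.
have k1 : (1 <= k)%N by exact: ltnW.
have /andP[al0 alk] := alpha_bnd k1.
have as0 : 0 <= alpha * sigma ^+ 2 by rewrite mulr_ge0.
have h1 : sigma ^+ 2 * gap k <= 1 * gap k.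
  by apply: ler_wpM2r => //; move: as0 alpha_ge0 param_lt1; lra.
have h2 : 4 * alpha_ k * sigma ^+ 2 * gap k.-1 <= 1 * gap k.-1.
  apply: ler_wpM2r => //; have := ler_wpM2r sigma2_ge0 alk.
  by move: as0 alpha_ge0 sigma2_ge0 param_lt1; lra.
have h3 : 0 <= 4 * alpha_ k * res k.-1 by rewrite !mulr_ge0.
lra.
Qed.

Lemma inertial_summable : zer T !=set0 ->
  [/\ cvgn (series (fun k => `|x k.+1 - x k| ^+ 2)),
      cvgn (series (fun k => `|x k - y k| ^+ 2)),
      cvgn (series (fun k => `|v k| ^+ 2)) & cvgn (series eps)].
Proof.
move=> [z Tz0]; have [gap_sum _] := inertial_lyapunov Tz0.
have gaps_sum : cvgn (series (fun k => gap k + gap k.-1)).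
  exact: is_cvg_seriesD gap_sum (is_cvg_series_pred gap_sum).
have incr_sum : cvgn (series incr).
  apply: (@is_cvg_series_dom _ 4 _ (fun k => gap k + gap k.-1) 2).
    move=> k k2; rewrite sqr_ge0 /=; apply: le_trans (incr_le k2) _.
    have := error_le k2; have := gap_ge0 k.-1.
    have : 0 <= 2 * c k * eps k.
      by rewrite !mulr_ge0 ?eps_ge0 // ltW // c_gt0 // ltnW.
    lra.
  exact: gaps_sum.
split=> //.
  apply: (@is_cvg_series_dom _ (2 / c_low ^+ 2) _
    (fun k => incr k + incr k.-1) 2) => [k k2|].
    rewrite sqr_ge0 /= mulrAC ler_pdivlMr ?exprn_gt0 //.
    have k1 : (1 <= k)%N by exact: ltnW.
    have /andP[al0 alk] := alpha_bnd k1.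
    have ck : c_low ^+ 2 <= c k ^+ 2.
      by rewrite ler_sqr ?nnegrE ?c_ge // ltW // c_gt0.
    apply: (@le_trans _ _ (`|c k *: v k| ^+ 2)).
      by rewrite normrZ exprMn real_normK ?num_real // mulrC ler_wpM2r ?sqr_ge0.
    (* The update rule solved for c k *: v k. *)
    have -> : c k *: v k = alpha_ k *: (x k - x k.-1) - (x k.+1 - x k).
      rewrite x_step // opprB addrA (addrC (alpha_ k *: _)) opprB.
      by rewrite [RHS]addrC subrK.
    apply: le_trans (sqr_normB_le2 ip_norm _ _) _.
    have -> : x k - x k.-1 = x k.-1.+1 - x k.-1 by rewrite prednK.
    rewrite normrZ exprMn real_normK ?num_real // -/(incr k) -/(incr k.-1).
    have al1 : alpha_ k ^+ 2 * incr k.-1 <= 1 * incr k.-1.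
      apply: ler_wpM2r; first exact: sqr_ge0.
      rewrite expr_le1 // (le_trans alk) //.
      have : 0 <= alpha * sigma ^+ 2 by rewrite mulr_ge0.
      by move: alpha_ge0 sigma2_ge0 param_lt1; lra.
    lra.
  exact: is_cvg_seriesD incr_sum (is_cvg_series_pred incr_sum).
apply: (@is_cvg_series_dom _ (2 * c_low)^-1 _
  (fun k => gap k + gap k.-1) 2) => [k k2|].
  rewrite eps_ge0 //= mulrC ler_pdivlMr ?mulr_gt0 //.
  have k1 : (1 <= k)%N by exact: ltnW.
  have := ler_wpM2r (eps_ge0 k2) (c_ge k1).
  have := error_le k2; have := res_ge0 k; lra.
exact: gaps_sum.
Qed.

Lemma inertial_weak_cvg : maximally_monotone ip T -> zer T !=set0 ->
  exists2 z, zer T z & weakly_converges ip x z.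
Proof.
move=> Tmax Tz; have [_ gap_sum v_sum eps_sum] := inertial_summable Tz.
have gap0 := sqr_norm_cvg0 (cvg_series_cvg_0 gap_sum).
have v0 := sqr_norm_cvg0 (cvg_series_cvg_0 v_sum).
have eps0 := cvg_series_cvg_0 eps_sum.
have xz z : zer T z -> cvgn (fun n => `|x n - z| ^+ 2).
  by move=> Tz0; have [] := inertial_lyapunov Tz0.
have [B xB] : exists B, forall n, `|x n| <= B.
  by have [z Tz0] := Tz; exact: bounded_sqr_dist (xz _ Tz0).
apply: (opial ip_norm Tz xz) => U p UU oU xp.
have gapU : (fun k => x k - y k) @ U --> 0 by move=> A /gap0; exact: oU.
apply: (@demiclosed _ _ _ ip_norm T _ U _ y v eps p (B + 1) Tmax).
- by apply: oU; exists 2%N => // k /=; exact: v_enl.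
- near=> k; have gk : `|x k - y k| <= 1.
    by near: k; exact: cvgr0_norm_le gapU _ ltr01.
  have -> : y k = x k - (x k - y k) by rewrite opprB [RHS]addrC subrK.
  by apply: le_trans (ler_normB _ _) _; exact: lerD.
- by move=> A /eps0; exact: oU.
- by move=> A /v0; exact: oU.
move=> u; rewrite -[ip p u]subr0.
have -> : (fun k => ip (y k) u) = (fun k => ip (x k) u - ip (x k - y k) u).
  by apply/funext => k; rewrite -linearBl opprB addrC subrK.
by apply: cvgB => //; rewrite -[0](linear0l ip u); exact: (ip_cvgl ip_norm).
Unshelve. all: by end_near. Qed.

End Iteration.

Theorem theorem6 (R : realType) (H : completeNormedModType R)
    (ip : {dot H for idfun}) (ip_norm : induces_norm ip)
    (T : H -> set H) (T_max : maximally_monotone ip T)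
    (zerT_neq0 : zer T !=set0)
    (x y v : nat -> H) (eps c alpha_ : nat -> R) (alpha sigma c_low : R)
    (alpha_ge0 : 0 <= alpha) (sigma_ge0 : 0 <= sigma) (c_low_gt0 : 0 < c_low)
    (c_ge : forall k : nat, (1 <= k)%N -> c_low <= c k)
    (alpha_bnd : forall k : nat, (1 <= k)%N -> 0 <= alpha_ k <= alpha)
    (param_lt1 : alpha * (5 + 4 * sigma ^+ 2) + sigma ^+ 2 < 1)
    (alpha_ndecr : forall k : nat, (1 <= k)%N -> alpha_ k <= alpha_ k.+1)
    (init : alpha_ 1%N = 0 \/ x 1%N = x 0%N)
    (eps_ge0 : forall k : nat, (2 <= k)%N -> 0 <= eps k)
    (v_enl : forall k : nat, (2 <= k)%N -> enlargement ip T (eps k) (y k) (v k))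
    (error_bnd : forall k : nat, (2 <= k)%N ->
       2 * c k * eps k
       + `|c k *: v k + y k - x k - alpha_ k *: (x k - x k.-1)| ^+ 2
       + 4 * alpha_ k *
         `|c k.-1 *: v k.-1 + y k.-1 - x k.-1
           - alpha_ k.-1 *: (x k.-1 - x k.-2)| ^+ 2
       <= sigma ^+ 2 * `|y k - x k| ^+ 2
          + 4 * alpha_ k * sigma ^+ 2 * `|y k.-1 - x k.-1| ^+ 2)
    (x_step : forall k : nat, (2 <= k)%N ->
       x k.+1 = x k + alpha_ k *: (x k - x k.-1) - c k *: v k) :
  [/\ (\sum_(0 <= k <oo) (`|x k.+1 - x k| ^+ 2)%:E < +oo)%E,
      (\sum_(0 <= k <oo) (`|x k - y k| ^+ 2)%:E < +oo)%E,
      (\sum_(1 <= k <oo) (`|v k| ^+ 2)%:E < +oo)%E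
    & (\sum_(2 <= k <oo) (eps k)%:E < +oo)%E]
  /\ exists2 z : H, zer T z & weakly_converges ip x z.
Proof.
have [dx_sum gap_sum v_sum eps_sum] := inertial_summable ip_norm alpha_ge0
  c_low_gt0 c_ge alpha_bnd param_lt1 alpha_ndecr eps_ge0 v_enl error_bnd x_step
  zerT_neq0.
split; first by split; exact: cvg_series_lt_pinfty.
exact: (inertial_weak_cvg ip_norm alpha_ge0 c_low_gt0 c_ge alpha_bnd param_lt1
  alpha_ndecr eps_ge0 v_enl error_bnd x_step T_max zerT_neq0).
Qed.
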